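(* Let $n\ge 1$ and let $\pi=\pi_1\pi_2\cdots\pi_n\in\mathfrak{S}_n$. Then the following are equivalent: (i) $\pi\in\mathcal{O}(\mathrm{LPF}_n)$; (ii) the arm-leg diagram of $\pi$ is non-intersecting; (iii) there do not exist $i<j$ in $[n]$ such that $n-j+1<n-i+1\le \pi_j<\pi_i$.
   Context: Let $[n]=\{1,\ldots,n\}$ and let $\mathfrak{S}_n$ be the set of permutations of $[n]$ in one-line notation. A Lehmer parking function of length $n$ is a tuple $\alpha=(a_1,\ldots,a_n)\in[n]^n$ with $a_i\le n-i+1$ for all $i\in[n]$; $\mathrm{LPF}_n$ is the set of these. Cars $1,2,\ldots,n$ arrive in this order on a one-way street with spots $1,\ldots,n$; car $i$ parks in the first empty spot at or after its preference $a_i$. A tuple is a parking function if all cars park; every Lehmer parking function is a parking function. The outcome $\mathcal{O}(\alpha)$ of a parking function $\alpha$ is the permutation $\pi=\pi_1\cdots\pi_n$ where $\pi_i=j$ means that spot $i$ is occupied by car $j$ at the end. $\mathcal{O}(\mathrm{LPF}_n)=\{\mathcal{O}(\alpha):\alpha\in\mathrm{LPF}_n\}$. Arm-leg diagram of $\pi$: plot the points $(i,\pi_i)$, $i\in[n]$, together with the antidiagonal $y=-x+(n+1)$. An entry $(i,\pi_i)$ lies at or above the antidiagonal if $\pi_i\ge n-i+1$. For each such entry, its arm is the horizontal segment from $(i,\pi_i)$ to the antidiagonal, i.e. $\{(x,\pi_i): n-\pi_i+1\le x\le i\}$, and its leg is the vertical segment from $(i,\pi_i)$ to the antidiagonal,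 i.e. $\{(i,y): n-i+1\le y\le \pi_i\}$. The arm-leg diagram is non-intersecting if no arm of one entry intersects the leg of a different entry. *)

(* Defs.v *)
From mathcomp Require Import all_boot all_order all_fingroup all_algebra.

Set Implicit Arguments.
Unset Strict Implicit.
Unset Printing Implicit Defensive.

Import Order.TTheory GRing.Theory Num.Theory.

(* Spots, cars, preferences and entries in [n] = {1, ..., n} are represented
   by 'I_n; [lab] recovers the 1-based label, in which all formulas are
   written.  A permutation pi_1 ... pi_n in one-line notation is pi : 'S_n with
   pi_(lab i) = lab (pi i).  As lab i <= n, the truncated subtractions
   n - lab i below are exact. *)
Definition lab n (i : 'I_n) : nat := i.+1.

Definition preferences n := {ffun 'I_n -> 'I_n}.

Definition LPF n : {set preferences n} :=
  [set alpha : preferences n | [forall i, lab (alpha i) <= n - lab i + 1]].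

(* [s p] is the car parked in spot [p], [None] if the spot is empty. *)
Definition street n := {ffun 'I_n -> option 'I_n}.

Definition first_empty n (s : street n) (a : 'I_n) : option 'I_n :=
  [pick p : 'I_n | [&& lab a <= lab p, s p == None
    & [forall q : 'I_n, (lab a <= lab q) && (s q == None)
                          ==> (lab p <= lab q)]]].

(* A car that finds no empty spot leaves the street unchanged. *)
Definition park n (alpha : preferences n) (s : street n) (c : 'I_n) :
    street n :=
  if first_empty s (alpha c) is Some p
  then [ffun q => if q == p then Some c else s q]
  else s.

(* [enum 'I_n] is increasing, so the cars arrive in the order 1, ..., n. *)
Definition final_street n (alpha : preferences n) : street n :=
  foldl (park alpha) [ffun=> None] (enum 'I_n).

Definition parking_function n (alpha : preferences n) : bool :=
  [forall c : 'I_n, exists p : 'I_n, final_street alpha p == Some c].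

Definition has_outcome n (alpha : preferences n) (pi : 'S_n) : bool :=
  parking_function alpha
  && [forall p : 'I_n, final_street alpha p == Some (pi p)].

Definition outcomes_LPF n : {set 'S_n} :=
  [set pi : 'S_n | [exists alpha in LPF n, has_outcome alpha pi]].

Definition at_or_above n (pi : 'S_n) (i : 'I_n) : bool :=
  n - lab i + 1 <= lab (pi i).

Local Open Scope ring_scope.

(* The segments are sets of points of the plane R * R, not just of lattice
   points. *)
Definition arm (R : realFieldType) n (pi : 'S_n) (i : 'I_n) : pred (R * R) :=
  fun z => (z.2 == (lab (pi i))%:R)
           && (n%:R - (lab (pi i))%:R + 1 <= z.1 <= (lab i)%:R).

Definition leg (R : realFieldType) n (pi : 'S_n) (i : 'I_n) : pred (R * R) :=
  fun z => (z.1 == (lab i)%:R)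
           && (n%:R - (lab i)%:R + 1 <= z.2 <= (lab (pi i))%:R).

Definition non_intersecting (R : realFieldType) n (pi : 'S_n) : Prop :=
  forall i j : 'I_n, i != j -> at_or_above pi i -> at_or_above pi j ->
    ~ exists z : R * R, arm pi i z /\ leg pi j z.

(* Main.v *)
Require Import Defs.
From mathcomp Require Import all_boot all_order all_fingroup all_algebra.
From mathcomp Require Import zify.

Set Implicit Arguments.
Unset Strict Implicit.
Unset Printing Implicit Defensive.

Import Order.TTheory GRing.Theory Num.Theory.

(** Write [i], [pi i] for the 0-based spots and cars, so that the antidiagonal
    is [i + pi i = n - 1].

    Parking is understood through one criterion ([has_outcomeP]): [pi] is the
    outcome of [alpha] exactly when, for each spot [p], the car [pi p] prefers
    a spot at or before [p] and every spot from its preference up to [p]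
    (excluded) holds an earlier car.  For a Lehmer parking function the
    preference of car [c] is at most [n - 1 - c].  Choosing the largest
    preference that is both Lehmer and at most [p], namely
    [minn p (n - 1 - c)], makes the criterion as weak as possible, so [pi] is
    an outcome of a Lehmer parking function iff every spot [i < j] with
    [n - 1 - pi j <= i] satisfies [pi i < pi j].  This is the avoidance of the
    forbidden pattern.

    On the geometric side, the horizontal line through the arm of [j] and the
    vertical line through the leg of [i] meet in the single point of labels
    [(i, pi j)].  It lies on both segments iff [i <= j], [pi j <= pi i] and
    [i + pi j >= n - 1]; for distinct entries the first two inequalities are
    strict, which is again the forbidden pattern ([arm_meets_legP]). *)

(** * Outcomes of parking *)

Lemma first_emptyP {n} (s : street n) (a p : 'I_n) :
  first_empty s a = Some p <->
  [/\ a <= p, s p = None & forall q : 'I_n, a <= q < p -> s q <> None].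
Proof.
have specP (r : 'I_n) : reflect
    [/\ a <= r, s r = None & forall q : 'I_n, a <= q < r -> s q <> None]
    [&& lab a <= lab r, s r == None
    & [forall q : 'I_n, (lab a <= lab q) && (s q == None)
                          ==> (lab r <= lab q)]].
  apply: (iffP and3P) => [[le_ar /eqP sr /forallP min_r]|[le_ar sr min_r]].
    split=> // q /andP[le_aq lt_qr] sq.
    have := min_r q; rewrite sq eqxx andbT /lab !ltnS le_aq /=.
    by rewrite leqNgt lt_qr.
  split; [by [] | exact/eqP | apply/forallP=> q; apply/implyP].
  case/andP=> le_aq /eqP sq; rewrite /lab ltnS leqNgt; apply/negP=> lt_qr.
  by apply: (min_r q) sq; rewrite lt_qr andbT.
rewrite /first_empty; case: pickP => [r /specP r_first|no_first]; last first.
  by split=> // /specP; rewrite no_first.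
split=> [[<-] // | [le_ap sp min_p]].
case: r_first => le_ar sr min_r; congr Some; apply: val_inj => /=.
case: (ltngtP r p) => // [lt_rp|lt_pr].
  by case: (min_p r); rewrite ?le_ar.
by case: (min_r p); rewrite ?le_ap.
Qed.

Definition street_before {n} (alpha : preferences n) (k : nat) : street n :=
  foldl (park alpha) [ffun=> None] (take k (enum 'I_n)).

Lemma street_before0 {n} (alpha : preferences n) :
  street_before alpha 0 = [ffun=> None].
Proof. by rewrite /street_before take0. Qed.

Lemma street_beforeS {n} (alpha : preferences n) (c : 'I_n) :
  street_before alpha c.+1 = park alpha (street_before alpha c) c.
Proof.
rewrite /street_before (take_nth c) ?size_enum_ord //.
by rewrite foldl_rcons nth_ord_enum.
Qed.

Lemma street_before_final {n} (alpha : preferences n) :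
  street_before alpha n = final_street alpha.
Proof. by rewrite /street_before take_oversize ?size_enum_ord. Qed.

Definition outcome_before {n} (pi : 'S_n) (k : nat) : street n :=
  [ffun q => if pi q < k then Some (pi q) else None].

Lemma outcome_before_None {n} (pi : 'S_n) (k : nat) (q : 'I_n) :
  outcome_before pi k q = None <-> k <= pi q.
Proof. by rewrite ffunE; case: ltnP. Qed.

Lemma first_empty_outcomeP {n} (pi : 'S_n) (a p : 'I_n) :
  first_empty (outcome_before pi (pi p)) a = Some p <->
  a <= p /\ forall q : 'I_n, a <= q < p -> pi q < pi p.
Proof.
rewrite first_emptyP; split=> [[le_ap _ min_p]|[le_ap early]].
  split=> // q /min_p; rewrite outcome_before_None => /negP.
  by rewrite -ltnNge.
split=> // [|q /early lt_q]; first exact/outcome_before_None.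
by rewrite outcome_before_None leqNgt lt_q.
Qed.

Lemma park_outcome_before {n} (alpha : preferences n) (pi : 'S_n) (p : 'I_n) :
  first_empty (outcome_before pi (pi p)) (alpha (pi p)) = Some p ->
  park alpha (outcome_before pi (pi p)) (pi p) = outcome_before pi (pi p).+1.
Proof.
move=> parks; rewrite /park parks; apply/ffunP=> q; rewrite !ffunE.
case: eqP => [->|/eqP neq_qp]; first by rewrite ltnS leqnn.
by rewrite ltnS [in RHS]leq_eqVlt val_eqE (inj_eq perm_inj) (negPf neq_qp).
Qed.

Lemma street_before_lt {n} (alpha : preferences n) (k : nat) (q c : 'I_n) :
  k <= n -> street_before alpha k q = Some c -> c < k.
Proof.
elim: k => [|k IHk] lt_kn; first by rewrite street_before0 ffunE.
rewrite (street_beforeS alpha (Ordinal lt_kn)) /park /=.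
have old : street_before alpha k q = Some c -> c < k.+1.
  by move/(IHk (ltnW lt_kn)) => /ltnW.
case: first_empty => [p|]; last exact: old.
by rewrite ffunE; case: eqP => [_ [<-]|_]; [exact: ltnSn | exact: old].
Qed.

(** Since car [c] can only fill an empty spot, and is not on the street before
    its turn, the street after its turn determines both the spot it took and
    the street before.  This lets the final outcome be traced back to the
    intermediate streets. *)
Lemma park_inv {n} (alpha : preferences n) (pi : 'S_n) (s : street n)
    (p : 'I_n) :
  (forall q, s q <> Some (pi p)) ->
  park alpha s (pi p) = outcome_before pi (pi p).+1 ->
  s = outcome_before pi (pi p) /\ first_empty s (alpha (pi p)) = Some p.
Proof.
move=> absent; rewrite /park.
case first_s: (first_empty s (alpha (pi p))) => [r|] parked; last first.
  by case: (absent p); rewrite parked ffunE ltnSn.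
have def_r : r = p.
  move/ffunP/(_ r): parked; rewrite !ffunE eqxx; case: ifP => // _ [].
  by move/perm_inj.
rewrite {}def_r in first_s parked *; split=> //; apply/ffunP=> q.
move/ffunP/(_ q): parked; rewrite !ffunE ltnS leq_eqVlt val_eqE.
rewrite (inj_eq perm_inj); case: eqP => [-> _|//].
by rewrite ltnn; case/first_emptyP: first_s.
Qed.

Lemma street_before_outcome {n} (alpha : preferences n) (pi : 'S_n) :
  final_street alpha = outcome_before pi n ->
  forall k, k <= n -> street_before alpha k = outcome_before pi k.
Proof.
move=> final k le_kn; rewrite -(subKn le_kn).
elim: (n - k) (leq_subr k n) => [|m IHm] lt_mn.
  by rewrite subn0 street_before_final.
have lt_cn : n - m.+1 < n by lia.
have [p def_p] : exists p, pi p = Ordinal lt_cn.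
  by exists ((pi^-1)%g (Ordinal lt_cn)); rewrite permKV.
have def_c : n - m.+1 = pi p by rewrite def_p.
have := IHm (ltnW lt_mn).
have -> : n - m = (pi p).+1 by lia.
rewrite def_c street_beforeS => parked.
apply: (proj1 (park_inv _ parked)) => q.
by move/(street_before_lt (ltnW (ltn_ord _))); rewrite ltnn.
Qed.

Lemma has_outcomeE {n} (alpha : preferences n) (pi : 'S_n) :
  has_outcome alpha pi <-> final_street alpha = outcome_before pi n.
Proof.
have full p : outcome_before pi n p = Some (pi p) by rewrite ffunE ltn_ord.
rewrite /has_outcome; split=> [/andP[_ /forallP final]|final].
  by apply/ffunP=> p; rewrite full; apply/eqP.
apply/andP; split; last by apply/forallP=> p; rewrite final full.
by apply/forallP=> c; apply/existsP; exists ((pi^-1)%g c); rewrite final full permKV.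
Qed.

(** The criterion is local: each car is tested against the street that [pi]
    predicts at its arrival.  From right to left this prediction is confirmed
    car by car; from left to right it comes from tracing the outcome back. *)
Lemma has_outcomeP {n} (alpha : preferences n) (pi : 'S_n) :
  has_outcome alpha pi <->
  forall p : 'I_n, alpha (pi p) <= p /\
    forall q : 'I_n, alpha (pi p) <= q < p -> pi q < pi p.
Proof.
rewrite has_outcomeE; split=> [final p|parks].
  apply/first_empty_outcomeP.
  have before := street_before_outcome final.
  have := before _ (ltn_ord (pi p)).
  rewrite street_beforeS before; last exact/ltnW.
  move=> parked; apply: (proj2 (park_inv _ parked)) => q.
  by rewrite ffunE; case: ifP => // lt_q [eq_q]; rewrite eq_q ltnn in lt_q.
suff before k : k <= n -> street_before alpha k = outcome_before pi k.
  by rewrite -street_before_final before.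
elim: k => [_|k IHk lt_kn]; first by rewrite street_before0; apply/ffunP=> q;
  rewrite !ffunE.
have := street_beforeS alpha (Ordinal lt_kn); rewrite /= IHk 1?ltnW // => ->.
have [p def_p] : exists p, pi p = Ordinal lt_kn.
  by exists ((pi^-1)%g (Ordinal lt_kn)); rewrite permKV.
rewrite -def_p; have -> : k = pi p by rewrite def_p.
exact/park_outcome_before/first_empty_outcomeP/parks.
Qed.

(** * The forbidden pattern *)

(** The arm of [j] crosses the leg of [i]; the middle condition is
    [n - 1 - pi j <= i] written without truncated subtraction. *)
Definition crossing {n} (pi : 'S_n) (i j : 'I_n) : bool :=
  [&& i < j, n <= i + (pi j).+1 & pi j < pi i].

Lemma crossingP {n} (pi : 'S_n) (i j : 'I_n) :
  (lab i < lab j /\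
   n - lab j + 1 < n - lab i + 1 <= lab (pi j) /\ lab (pi j) < lab (pi i))
  <-> crossing pi i j.
Proof.
have := ltn_ord i; have := ltn_ord j; rewrite /crossing /lab => lt_jn lt_in.
by split; lia.
Qed.

Lemma in_LPF {n} (alpha : preferences n) :
  reflect (forall c : 'I_n, c + alpha c < n) (alpha \in LPF n).
Proof.
rewrite inE; apply: (iffP forallP) => lehmer c;
  have := lehmer c; have := ltn_ord c; rewrite /lab; lia.
Qed.

(** The car of the later spot [j] prefers a spot at or before [i], and [i] is
    still empty at its arrival. *)
Lemma outcome_not_crossing {n} (pi : 'S_n) (i j : 'I_n) :
  pi \in outcomes_LPF n -> ~~ crossing pi i j.
Proof.
rewrite inE => /existsP[alpha /andP[/in_LPF lehmer /has_outcomeP parks]].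
apply/and3P=> -[lt_ij le_n lt_pi]; have [_ /(_ i) early] := parks j.
have := lehmer (pi j); move: early; lia.
Qed.

Lemma not_crossing_outcome {n} (pi : 'S_n) :
  (forall i j, ~~ crossing pi i j) -> pi \in outcomes_LPF n.
Proof.
move=> avoid; rewrite inE; apply/existsP.
have lt_pref (c : 'I_n) : minn ((pi^-1)%g c) (n - c.+1) < n.
  by have := ltn_ord c; lia.
exists [ffun c => Ordinal (lt_pref c)]; apply/andP; split.
  by apply/in_LPF=> c; rewrite ffunE /=; have := ltn_ord c; lia.
apply/has_outcomeP=> p; rewrite ffunE /= permK; split=> [|q]; first lia.
move=> range_q; have := avoid q p; rewrite /crossing.
(* Avoidance excludes [pi p < pi q]; injectivity excludes equality. *)
have : pi q != pi p :> nat.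
  by rewrite val_eqE (inj_eq perm_inj); apply/eqP=> eq_qp;
    rewrite eq_qp ltnn andbF in range_q.
have := ltn_ord (pi p); lia.
Qed.

(** * Arms and legs *)

Local Open Scope ring_scope.

Lemma antidiagonal_le (R : realFieldType) n (a b : nat) :
  (n%:R - a.+1%:R + 1 <= b.+1%:R :> R) = (n <= a + b.+1)%N.
Proof. by rewrite -natr1 opprD addrA subrK lerBlDl -natrD ler_nat. Qed.

Lemma arm_meets_legP (R : realFieldType) {n} (pi : 'S_n) (i j : 'I_n) :
  i != j ->
  (exists z : R * R, arm pi j z /\ leg pi i z) <-> crossing pi i j.
Proof.
move=> neq_ij.
have neq_pi : pi i != pi j by rewrite (inj_eq perm_inj).
rewrite -!val_eqE /= in neq_ij neq_pi.
rewrite /arm /leg /lab; split.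
  case=> -[x y] /= [/andP[/eqP -> x_arm] /andP[/eqP def_x]].
  move: x_arm; rewrite def_x !antidiagonal_le !ler_nat /crossing; lia.
move=> cross; exists ((i.+1)%:R, (pi j).+1%:R) => /=.
rewrite !eqxx !antidiagonal_le !ler_nat; move: cross; rewrite /crossing; lia.
Qed.

Lemma crossing_at_or_above {n} (pi : 'S_n) (i j : 'I_n) :
  crossing pi i j -> at_or_above pi i && at_or_above pi j.
Proof.
have := ltn_ord i; have := ltn_ord j.
rewrite /crossing /at_or_above /lab; lia.
Qed.

Lemma non_intersectingP (R : realFieldType) {n} (pi : 'S_n) :
  non_intersecting R pi <-> forall i j, ~~ crossing pi i j.
Proof.
split=> [disj i j|avoid j i neq_ji _ _]; last first.
  by rewrite arm_meets_legP 1?eq_sym //; apply/negP.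
apply/negP=> cross; have /andP[above_i above_j] := crossing_at_or_above cross.
have neq_ij : i != j by case/and3P: cross; rewrite -val_eqE /=; lia.
apply: (disj j i) => //; first by rewrite eq_sym.
exact/arm_meets_legP.
Qed.

Local Close Scope ring_scope.

Theorem theorem2p1 (R : realFieldType) (n : nat) (hn : 0 < n) (pi : 'S_n) :
  [<-> pi \in outcomes_LPF n;
       non_intersecting R pi;
       ~ exists i j : 'I_n,
           lab i < lab j /\
           n - lab j + 1 < n - lab i + 1 <= lab (pi j) /\
           lab (pi j) < lab (pi i)].
Proof.
tfae.
- by move=> outcome; apply/non_intersectingP=> i j; apply: outcome_not_crossing.
- by move/non_intersectingP=> avoid [i [j /crossingP]]; apply/negP.
- move=> avoid; apply: not_crossing_outcome => i j; apply/negP=> cross.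
  by apply: avoid; exists i, j; apply/crossingP.
Qed.
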